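(* Consider the multi-level, multi-user caching problem described in the context, with parameters $K\ge 1$, $L\ge 1$, $\{N_i,U_i\}_{i=1}^L$ satisfying the two regularity conditions, and cache memory $M\ge 0$. Let $R(M)$ be the rate achieved by the memory-sharing scheme defined in the context, and let $R^\ast(M)$ be the optimal rate. Then \[ R(M)\le 192\, R^\ast(M). \]
   Context: Multi-level, multi-user caching problem. A server holds $\sum_{i=1}^L N_i$ files, each of $F$ bits, partitioned into $L$ popularity levels, level $i$ consisting of $N_i$ files. There are $K$ caches, each able to store $MF$ bits. In a placement phase (before requests are known) arbitrary functions of the files are stored in the caches. Then, for each level $i$ and each cache, exactly $U_i$ users are connected to that cache and each of them requests an arbitrary file of level $i$ (a demand is any such assignment of requested files). The server then sends one broadcast message of $RF$ bits heard by all users, and each user must recover its requested file from the broadcast and the contents of the cache it is connected to. A pair $(R,M)$ is achievable if there is a placement-and-delivery strategy with caches of memory $M$ that, for every admissible demand, uses a broadcast of rate at most $R$ satisfying all requests (with vanishing error probability as $F\to\infty$). The optimal rate is $R^\ast(M)=\inf\{R:(R,M)\text{ achievable}\}$. Regularity conditions: (1) $N_i\ge KU_i$ for every $i$; (2) with $\beta=1/80$, for any two distinct levels $i,j$ with $U_i/N_i\ge U_j/N_j$, one has $\frac{U_i/N_i}{U_j/N_j}\ge 1/\beta^2$. Single-level rate: for $M\ge0$, $R^{\mathrm{SL}}(M,K,N,U)=U\cdot\min\{N/M,\,K\}\cdot(1-M/N)$ (with $N/0=\infty$). Memory-sharing scheme: level $i$ is given memory $\alpha_iM$ with $\alpha_i\in[0,1]$,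 $\sum_i\alpha_i=1$, and is served as a separate single-level system, giving total rate $R(M)=\sum_{i=1}^L R^{\mathrm{SL}}(\alpha_iM,K,N_i,U_i)$. The allocation is as follows. For a subset $A$ of levels put $S_A=\sum_{i\in A}\sqrt{N_iU_i}$, $T_A=\sum_{i\in A}N_i$, $V_A=\sum_{i\in A}N_i/K$. For $M<\sum_iN_i$, an $M$-feasible partition is a partition $(H,I,J)$ of $\{1,\dots,L\}$ with $I\neq\emptyset$ such that, writing $\tilde M=(M-T_J+V_I)/S_I$: $\tilde M<(1/K)\sqrt{N_h/U_h}$ for all $h\in H$; $(1/K)\sqrt{N_i/U_i}\le\tilde M\le(1+1/K)\sqrt{N_i/U_i}$ for all $i\in I$; $(1+1/K)\sqrt{N_j/U_j}<\tilde M$ for all $j\in J$ (such a partition exists). Given it, set $\alpha_hM=0$ for $h\in H$, $\alpha_iM=\sqrt{N_iU_i}\,\tilde M-N_i/K$ for $i\in I$, $\alpha_jM=N_j$ for $j\in J$. (If $M\ge\sum_iN_i$, every level stores all its files, $\alpha_iM=N_i$.) *)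

(* Defs.v *)
From HB Require Import structures.
From mathcomp Require Import all_boot all_order all_algebra.
From mathcomp Require Import classical_sets reals.
Set Implicit Arguments. Unset Strict Implicit. Unset Printing Implicit Defensive.
Import Order.TTheory GRing.Theory Num.Theory.
Local Open Scope ring_scope.
Local Open Scope classical_set_scope.

Section Caching.
Variable R : realType.
Variables (K L : nat) (N U : 'I_L -> nat).

Definition fileIdx := {i : 'I_L & 'I_(N i)}.
Definition bits (n : nat) := {ffun 'I_n -> bool}.
Definition library (F : nat) := {ffun fileIdx -> bits F}.
(* a demand: for level i, cache k and user u (< U_i) at that cache,
   the requested file of level i *)
Definition demand := forall i : 'I_L, 'I_K -> 'I_(U i) -> 'I_(N i).

Record scheme (F mc mr : nat) := Scheme {
  placement : 'I_K -> library F -> bits mc;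
  delivery  : demand -> library F -> bits mr;
  decoder   : demand -> forall i : 'I_L, 'I_K -> 'I_(U i) ->
                bits mr -> bits mc -> bits F
}.

Definition error_event F mc mr (s : scheme F mc mr) (d : demand) : pred (library F) :=
  fun W => [exists i : 'I_L, exists k : 'I_K, exists u : 'I_(U i),
    @decoder F mc mr s d i k u (@delivery F mc mr s d W) (@placement F mc mr s k W)
      != W (Tagged (fun j => 'I_(N j)) (d i k u))].

(* error probability, files i.i.d. uniform *)
Definition perr F mc mr (s : scheme F mc mr) (d : demand) : R :=
  #|error_event s d|%:R / #|{: library F}|%:R.

Definition achievable (Rt M : R) : Prop :=
  0 <= Rt /\
  forall eps : R, 0 < eps -> exists F0 : nat, forall F : nat, (F0 <= F)%N ->
    exists s : scheme F (Num.truncn (M * F%:R)) (Num.truncn (Rt * F%:R)),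
      forall d : demand, perr s d <= eps.

Definition Rstar (M : R) : R := inf [set Rt : R | achievable Rt M].

(* single-level rate, with N/0 = +oo *)
Definition RSL (M : R) (n u : nat) : R :=
  u%:R * (if M == 0 then K%:R else Num.min (n%:R / M) K%:R) * (1 - M / n%:R).

Inductive cls := cH | cI | cJ.
Definition isI (c : cls) : bool := if c is cI then true else false.
Definition isJ (c : cls) : bool := if c is cJ then true else false.

Definition SI (p : 'I_L -> cls) : R :=
  \sum_(i < L | isI (p i)) Num.sqrt ((N i)%:R * (U i)%:R).
Definition TJ (p : 'I_L -> cls) : R := \sum_(i < L | isJ (p i)) (N i)%:R.
Definition VI (p : 'I_L -> cls) : R := \sum_(i < L | isI (p i)) (N i)%:R / K%:R.

Definition Mtilde (M : R) (p : 'I_L -> cls) : R := (M - TJ p + VI p) / SI p.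

Definition rt (i : 'I_L) : R := Num.sqrt ((N i)%:R / (U i)%:R).

(* (H,I,J) given by p (p i = cH / cI / cJ) is an M-feasible partition *)
Definition feasible (M : R) (p : 'I_L -> cls) : Prop :=
  (exists i, p i = cI) /\
  forall i : 'I_L, match p i with
  | cH => Mtilde M p < K%:R^-1 * rt i
  | cI => K%:R^-1 * rt i <= Mtilde M p <= (1 + K%:R^-1) * rt i
  | cJ => (1 + K%:R^-1) * rt i < Mtilde M p
  end.

Definition alloc (M : R) (p : 'I_L -> cls) (i : 'I_L) : R :=
  match p i with
  | cH => 0
  | cI => Num.sqrt ((N i)%:R * (U i)%:R) * Mtilde M p - (N i)%:R / K%:R
  | cJ => (N i)%:R
  end.

Definition totN : R := \sum_(i < L) (N i)%:R.

Definition msrate (M r : R) : Prop :=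
  (M < totN /\ exists p, feasible M p /\
      r = \sum_(i < L) RSL (alloc M p i) (N i) (U i))
  \/ (totN <= M /\ r = \sum_(i < L) RSL (N i)%:R (N i) (U i)).

End Caching.

(* Main.v *)
(** The lower bound is a tree of submodularity steps. Uniformly on the libraries
    that are decoded correctly, caches and broadcasts are grouped in blocks of
    [s] caches and [q * s] broadcasts, with [s] running through powers of two.
    When two blocks of size [s] are merged, the files decoded by both are counted
    twice, so H(Z, Y) of the union is at most the sum of the two minus the entropy
    of those files. A level whose files become decodable at size [s] thus
    contributes N/s per cache, and M + q R dominates the sum over all levels of
    min(N, q s^2 U)/s.

    With m = M~ and q of order m^2, choose s = 1 for the levels of J, s about
    sqrt(N/U)/(2m) for those of I and s about K for those of H: level by level,
    min(N, q s^2 U)/s exceeds the memory allotted to the level by q/192 times its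
    rate. Since the allotted memories add up to M, summing proves the theorem. *)

Require Import Defs.
From HB Require Import structures.
From mathcomp Require Import all_boot all_order all_algebra.
From mathcomp Require Import classical_sets reals exp.
From mathcomp Require Import ring lra zify.
Set Implicit Arguments. Unset Strict Implicit. Unset Printing Implicit Defensive.
Import Order.TTheory GRing.Theory Num.Theory.
Local Open Scope ring_scope.

(** * Entropy of partitions of a finite set *)

Section Entropy.
Variables (R : realType) (T : finType) (G : {set T}).
Implicit Types (e : rel T) (w x y : T).

Definition block e w := #|[set x in G | e w x]|.

(* [#|G|] times the entropy, in nats, of the partition of [G] into classes of
   [e], under the uniform distribution. *)
Definition ent e : R := \sum_(w in G) ln (#|G|%:R / (block e w)%:R).

Definition meet e1 e2 : rel T := [rel x y | e1 x y && e2 x y].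

Lemma meet_equiv e1 e2 : equivalence_rel e1 -> equivalence_rel e2 ->
  equivalence_rel (meet e1 e2).
Proof.
move=> q1 q2 x y z; rewrite /meet /= (q1 z z z) (q2 z z z); split=> // /andP[h1 h2].
by rewrite (q1 x y z).2 // (q2 x y z).2.
Qed.

Lemma block_gt0 e w : equivalence_rel e -> w \in G -> (0 < block e w)%N.
Proof. by move=> qe Gw; apply/card_gt0P; exists w; rewrite inE Gw (qe w w w). Qed.

Lemma equiv_sym e x y : equivalence_rel e -> e x y = e y x.
Proof.
move=> qe; apply/idP/idP => h; first by rewrite -((qe x y x).2 h) (qe x x x).
by rewrite -((qe y x y).2 h) (qe y y y).
Qed.

Lemma eq_block e x y : equivalence_rel e -> e x y -> block e x = block e y.
Proof.
by move=> qe h; apply: eq_card => z; rewrite !inE ((qe x y z).2 h).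
Qed.

Lemma sum_block_inv e (A : {set T}) : equivalence_rel e ->
  (forall x y, x \in A -> y \in A -> e x y) -> A \subset G ->
  \sum_(w in A) (block e w)%:R^-1 <= 1 :> R.
Proof.
move=> qe eA /fintype.subsetP AG.
have [->|[x Ax]] := set_0Vmem A; first by rewrite big_set0 ler01.
rewrite (eq_bigr (fun=> (block e x)%:R^-1)) => [|w Aw]; last first.
  by rewrite (eq_block qe (eA _ _ Aw Ax)).
rewrite sumr_const -[leLHS]mulr_natl ler_pdivrMr ?ltr0n ?block_gt0 ?AG // mul1r ler_nat.
apply/subset_leq_card/fintype.subsetP => y Ay.
by rewrite inE AG // eA.
Qed.

(** The numerator counts pairs of an [x] in the [e1]-class and a [y] in the [e2]-class of [w]. For a
    fixed pair the admissible [w] lie in one class of the meet and contribute at most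
    [1 / block e3 x]; the pairs with [e3 x y] then sum to the size of [G]. *)
Lemma sum_block_ratio e1 e2 e3 :
  equivalence_rel e1 -> equivalence_rel e2 -> equivalence_rel e3 ->
  {in G &, forall x y, e1 x y -> e3 x y} ->
  {in G &, forall x y, e2 x y -> e3 x y} ->
  \sum_(w in G) ((block e1 w)%:R * (block e2 w)%:R) /
     ((block (meet e1 e2) w)%:R * (block e3 w)%:R) <= #|G|%:R :> R.
Proof.
move=> q1 q2 q3 s1 s2; have q12 := meet_equiv q1 q2.
have sumE e w (c : R) : (block e w)%:R * c = \sum_(x in G | e w x) c.
  by rewrite sumr_const mulr_natl; congr (_ *+ _); apply: eq_card => x; rewrite !inE.
have -> : \sum_(w in G) ((block e1 w)%:R * (block e2 w)%:R) /
     ((block (meet e1 e2) w)%:R * (block e3 w)%:R) =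
   \sum_(x in G) \sum_(y in G | e3 x y) \sum_(w in G | e1 x w && e2 y w)
      ((block e3 x)%:R^-1 * (block (meet e1 e2) w)%:R^-1 : R).
  rewrite (eq_bigr (fun w => \sum_(x in G | e1 w x) \sum_(y in G | e2 w y)
      ((block e3 x)%:R^-1 * (block (meet e1 e2) w)%:R^-1 : R))) => [|w Gw]; last first.
    rewrite -mulrA sumE; apply: eq_bigr => x /andP[Gx wx].
    rewrite sumE; apply: eq_bigr => y _.
    by rewrite invfM mulrC (eq_block q3 (s1 _ _ Gw Gx wx)).
  rewrite (exchange_big_dep (mem G)) /=; last by move=> ? ? _ /andP[].
  apply: eq_bigr => x Gx.
  rewrite (exchange_big_dep (fun y => (y \in G) && e3 x y)) /=; last first.
    move=> w y /and3P[Gw _ wx] /andP[Gy wy]; rewrite Gy.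
    by rewrite -((q3 w x y).2 (s1 _ _ Gw Gx wx)) s2.
  apply: eq_bigr => y /andP[Gy xy]; apply: eq_bigl => w.
  by rewrite Gx Gy ?andTb /= (equiv_sym w x q1) (equiv_sym w y q2) andbA.
have -> : #|G|%:R = \sum_(x in G) \sum_(y in G | e3 x y) (block e3 x)%:R^-1 :> R.
  rewrite -sum1_card natr_sum; apply: eq_bigr => x Gx.
  by rewrite -sumE mulfV // pnatr_eq0 -lt0n block_gt0.
apply: ler_sum => x Gx; apply: ler_sum => y /andP[Gy xy].
rewrite -mulr_sumr ger_pMr ?invr_gt0 ?ltr0n ?block_gt0 //.
rewrite (eq_bigl (fun w => w \in [set w in G | e1 x w && e2 y w])); last first.
  by move=> w; rewrite inE.
apply: sum_block_inv => // [u v|]; last by apply/fintype.subsetP => w; rewrite inE => /andP[].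
rewrite !inE => /andP[_ /andP[xu yu]] /andP[_ /andP[xv yv]].
by rewrite /meet /= -((q1 x u v).2 xu) xv -((q2 y u v).2 yu) yv.
Qed.

Lemma ln_le_subr1 (x : R) : 0 < x -> ln x <= x - 1.
Proof. by move=> x0; have := @le_ln1Dx R (x - 1); rewrite addrCA subrr addr0; apply; lra. Qed.

(** Applied pointwise, [ln x <= x - 1] reduces submodularity of entropy to [sum_block_ratio]; [e3]
    is information that [e1] and [e2] both determine. *)
Lemma ent_submod e1 e2 e3 :
  equivalence_rel e1 -> equivalence_rel e2 -> equivalence_rel e3 ->
  {in G &, forall x y, e1 x y -> e3 x y} ->
  {in G &, forall x y, e2 x y -> e3 x y} ->
  ent (meet e1 e2) + ent e3 <= ent e1 + ent e2.
Proof.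
move=> q1 q2 q3 s1 s2; have q12 := meet_equiv q1 q2.
rewrite -subr_le0 /ent -!big_split -sumrB /=.
apply: le_trans (_ : \sum_(w in G) (((block e1 w)%:R * (block e2 w)%:R) /
     ((block (meet e1 e2) w)%:R * (block e3 w)%:R) - 1) <= 0 :> R); last first.
  by rewrite sumrB subr_le0 sumr_const; exact: sum_block_ratio.
apply: ler_sum => w Gw.
have pG : 0 < #|G|%:R :> R by rewrite ltr0n; apply/card_gt0P; exists w.
have p e : equivalence_rel e -> 0 < (block e w)%:R :> R.
  by move=> qe; rewrite ltr0n block_gt0.
have [[[p1 p2] p3] p12] := (p _ q1, p _ q2, p _ q3, p _ q12).
apply: le_trans (ln_le_subr1 _); last by rewrite divr_gt0 ?mulr_gt0.
by rewrite [leRHS]ln_div ?posrE ?mulr_gt0 // !ln_div ?posrE // !lnM ?posrE //; lra.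
Qed.

(** Gibbs' inequality against the uniform law on [A], again from [ln x <= x - 1]. *)
Lemma ent_kernel_le (S : finType) (f : T -> S) (A : {pred S}) e :
  (forall x y, e x y = (f x == f y)) -> {in G, forall x, f x \in A} ->
  ent e <= #|G|%:R * ln #|A|%:R.
Proof.
move=> ef fA.
have qe : equivalence_rel e.
  by move=> x y z; rewrite !ef eqxx; split=> // /eqP ->.
rewrite /ent; have [->|[w0 Gw0]] := set_0Vmem G; first by rewrite big_set0 cards0 mul0r.
have A0 : 0 < #|A|%:R :> R by rewrite ltr0n; apply/card_gt0P; exists (f w0); exact: fA.
have pG : 0 < #|G|%:R :> R by rewrite ltr0n; apply/card_gt0P; exists w0.
have -> : #|G|%:R * ln #|A|%:R = \sum_(w in G) ln #|A|%:R :> R.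
  by rewrite sumr_const mulr_natl.
rewrite -subr_le0 -sumrB.
apply: le_trans (_ : \sum_(w in G) (#|G|%:R / ((block e w)%:R * #|A|%:R) - 1) <= 0 :> R).
  apply: ler_sum => w Gw.
  have p : 0 < (block e w)%:R :> R by rewrite ltr0n block_gt0.
  apply: le_trans (ln_le_subr1 _); last by rewrite divr_gt0 ?mulr_gt0.
  by rewrite !ln_div ?posrE ?mulr_gt0 // [ln (_ * _)]lnM ?posrE //; lra.
rewrite sumrB sumr_const subr_le0.
under eq_bigr do rewrite invfM mulrA mulrAC.
rewrite -mulr_sumr -[leRHS]mulr1 -mulrA ler_pM2l // mulrC ler_pdivrMr // mul1r.
rewrite (partition_big f (mem A)) //= -[#|A|]sum1_card natr_sum.
apply: ler_sum => a _.
rewrite (eq_bigl (fun w => w \in [set w in G | f w == a])); last by move=> w; rewrite inE.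
apply: sum_block_inv => // [x y|]; last by apply/fintype.subsetP => x; rewrite inE => /andP[].
by rewrite !inE ef => /andP[_ /eqP->] /andP[_ /eqP->].
Qed.

Lemma ent_ge e (c : R) : equivalence_rel e -> 0 < c ->
  {in G, forall w, c * (block e w)%:R <= #|G|%:R} -> #|G|%:R * ln c <= ent e.
Proof.
move=> qe c0 h; rewrite mulr_natl -[leLHS]sumr_const; apply: ler_sum => w Gw.
have p : 0 < (block e w)%:R :> R by rewrite ltr0n block_gt0.
have pG : 0 < #|G|%:R :> R by rewrite ltr0n; apply/card_gt0P; exists w.
by rewrite ler_ln ?posrE ?divr_gt0 // ler_pdivlMr // h.
Qed.

Lemma ent_sub e1 e2 : equivalence_rel e1 -> equivalence_rel e2 ->
  {in G &, forall x y, e1 x y -> e2 x y} -> ent e2 <= ent e1.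
Proof.
move=> q1 q2 s; apply: ler_sum => w Gw.
have pG : 0 < #|G|%:R :> R by rewrite ltr0n; apply/card_gt0P; exists w.
have p e : equivalence_rel e -> 0 < (block e w)%:R :> R by move=> qe; rewrite ltr0n block_gt0.
rewrite ler_ln ?posrE ?divr_gt0 ?p // ler_pM2l // lef_pV2 ?posrE ?p // ler_nat.
by apply/subset_leq_card/fintype.subsetP => x; rewrite !inE => /andP[Gx h]; rewrite Gx s.
Qed.

Lemma ent_meet_le e1 e2 : equivalence_rel e1 -> equivalence_rel e2 ->
  ent (meet e1 e2) <= ent e1 + ent e2.
Proof.
move=> q1 q2; apply: le_trans (ent_submod (e3 := fun _ _ => true) q1 q2 _ _ _) => //.
rewrite lerDl; apply: sumr_ge0 => w Gw; rewrite ln_ge0 // /block.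
rewrite (_ : [set x in G | true] = G); last by apply/setP => x; rewrite inE andbT.
by rewrite divff // pnatr_eq0 -lt0n; apply/card_gt0P; exists w.
Qed.

Lemma agree_equiv (I : finType) (S : I -> eqType) (D : {pred I})
    (Z : forall i, T -> S i) :
  equivalence_rel [rel x y | [forall i, (i \in D) ==> (Z i x == Z i y)]].
Proof.
move=> x y z /=; split=> [|/forallP h]; first by apply/forallP => i; rewrite eqxx implybT.
by apply: eq_forallb => i; have /= := h i; case: (i \in D) => //= /eqP ->.
Qed.

Lemma ent_agree_le (I S : finType) (D : {pred I}) (Z : I -> T -> S) (a : S) :
  ent [rel x y | [forall i, (i \in D) ==> (Z i x == Z i y)]]
    <= #|G|%:R * (#|D|%:R * ln #|S|%:R).
Proof.
have S0 : 0 < #|S|%:R :> R by rewrite ltr0n; apply/card_gt0P; exists a.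
(* Filling in [a] outside [D] makes the relation the kernel of a map with only [#|S| ^ #|D|]
   possible values. *)
pose f x := [ffun i => if i \in D then Z i x else a].
have -> : #|D|%:R * ln #|S|%:R = ln #|pffun_on a D (predT : {pred S})|%:R :> R.
  by rewrite card_pffun_on (eq_card (_ : predT =i S)) // natrX lnXn // mulr_natl.
apply: (@ent_kernel_le _ f).
  move=> x y /=; apply/forallP/eqP => [h|/ffunP h i].
    by apply/ffunP => i; rewrite !ffunE; case: (i \in D) (h i) => //= /eqP.
  by have := h i; rewrite !ffunE; case: (i \in D) => //= ->.
move=> x _; apply/pffun_onP; split=> //.
by apply/supportP => i /negbTE Di; rewrite ffunE Di.
Qed.

End Entropy.

Lemma card_agree_le (I S : finType) (A : {pred I}) (w : {ffun I -> S}) :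
  (#|S| ^ #|A| * #|[set x : {ffun I -> S} | [forall i, (i \in A) ==> (w i == x i)]]|
     <= #|S| ^ #|I|)%N.
Proof.
rewrite -(cardC A) expnD leq_mul2l; apply/orP; right.
pose Fm i : {pred S} := if i \in A then pred1 (w i) else predT.
apply: (@leq_trans #|family Fm|).
  apply/subset_leq_card/fintype.subsetP => x; rewrite inE => /forallP h.
  by apply/familyP => i; rewrite /Fm; case: (i \in A) (h i) => //= /eqP ->; rewrite inE.
rewrite card_family /image_mem foldrE big_map big_enum /= (bigID (mem A)) /=.
rewrite big1 ?mul1n => [|i Ai]; last by rewrite /Fm Ai card1.
rewrite (eq_bigr (fun=> #|S|)) => [|i Ai]; last by rewrite /Fm (negbTE Ai); apply: eq_card.
by rewrite prod_nat_const.
Qed.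

(** * Grouping caches and broadcasts along a binary tree *)

Section Tree.
Variables (R : realType) (K L : nat) (N U : 'I_L -> nat).
Variables (s0 b n : nat) (kk : 'I_L -> nat).
Hypotheses (Npos : forall i, (0 < N i)%N) (s0_gt0 : (0 < s0)%N) (b_gt0 : (0 < b)%N).
Hypotheses (s0nK : (s0 * 2 ^ n <= K)%N) (kkn : forall i, (kk i <= n)%N).

(* At stage [k] the first [s0 * 2 ^ n] caches and the [b * 2 ^ n] broadcasts are
   split into [2 ^ (n - k)] groups of [s0 * 2 ^ k] caches and [b * 2 ^ k]
   broadcasts. The demands are such that every group of stage [kk i] requests
   each of the first [dec i] files of level [i]. *)
Definition dec (i : 'I_L) := minn (N i) (s0 * 2 ^ kk i * (b * 2 ^ kk i) * U i).

(** Broadcast, cache and user are the digits of one mixed-radix number, so a group of stage [kk i]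
    runs through consecutive file numbers from 0 on. *)
Definition tree_demand (t : nat) : demand K N U := fun i c u =>
  Ordinal (ltn_pmod
    ((t %% (b * 2 ^ kk i) * (s0 * 2 ^ kk i) + c %% (s0 * 2 ^ kk i)) * U i + u)
    (Npos i)).

Variables (F mc mr : nat) (s : scheme K N U F mc mr).

(** The entropies below are taken under the uniform law on this set, where decoding is exact; a
    count of [good] takes the place of Fano's inequality. *)
Definition good : {set library N F} :=
  [set x | [forall t : 'I_(b * 2 ^ n), ~~ error_event s (tree_demand t) x]].

Definition caches_agree k g : rel (library N F) :=
  [rel x y : library N F | [forall c : 'I_K,
     (c \in [pred c : 'I_K | (c %/ (s0 * 2 ^ k) == g)%N]) ==>
      (placement s c x == placement s c y)]].

Definition broadcasts_agree k g : rel (library N F) :=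
  [rel x y : library N F | [forall t : 'I_(b * 2 ^ n),
     (t \in [pred t : 'I__ | (t %/ (b * 2 ^ k) == g)%N]) ==>
      (delivery s (tree_demand t) x == delivery s (tree_demand t) y)]].

Definition group_agree k g := meet (caches_agree k g) (broadcasts_agree k g).

Definition decoded k : {pred fileIdx N} :=
  [pred p : fileIdx N | (kk (tag p) <= k)%N && (tagged p < dec (tag p))%N].

Definition files_agree k : rel (library N F) :=
  [rel x y : library N F | [forall p, (p \in decoded k) ==> (x p == y p)]].

Lemma group_equiv k g : equivalence_rel (group_agree k g).
Proof. by apply: meet_equiv; apply: agree_equiv. Qed.

Lemma files_equiv k : equivalence_rel (files_agree k).
Proof. exact: (@agree_equiv _ _ _ _ (fun p (x : library N F) => x p)). Qed.

(** [c'] is the member with offset [c] of the first stage-[k] subgroup inside group [g] of stage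
    [j]. *)
Lemma group_index a m k g c j : (k <= j)%N -> (c < a * 2 ^ k)%N -> (0 < a)%N ->
  (g < 2 ^ (m - j))%N -> (j <= m)%N ->
  let c' := (g * 2 ^ (j - k) * (a * 2 ^ k) + c)%N in
  [/\ (c' < a * 2 ^ m)%N, c' %/ (a * 2 ^ j) = g & c' %% (a * 2 ^ k) = c]%N.
Proof.
move=> kj ck a0 gm jm c'.
have ak0 : (0 < a * 2 ^ k)%N by rewrite muln_gt0 a0 expn_gt0.
have ej : (a * 2 ^ j = a * 2 ^ k * 2 ^ (j - k))%N by rewrite -mulnA -expnD subnKC.
have em : (a * 2 ^ m = 2 ^ (m - j) * (a * 2 ^ j))%N.
  by rewrite mulnCA -expnD subnK.
have dj : (c' %/ (a * 2 ^ j) = g)%N.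
  by rewrite ej divnMA /c' divnMDl // (divn_small ck) addn0 mulnK // expn_gt0.
split=> //; last by rewrite /c' modnMDl modn_small.
by rewrite em -ltn_divLR ?dj // muln_gt0 a0 expn_gt0.
Qed.

(** The mixed-radix digits of [f] name a broadcast and a cache of group [g] and a user who requests
    [f]. Libraries that agree on that cache and broadcast yield the same decoded file. *)
Lemma group_decodes k g : (k <= n)%N -> (g < 2 ^ (n - k))%N ->
  {in good &, forall x y, group_agree k g x y -> files_agree k x y}.
Proof.
move=> kn gk x y; rewrite !inE => /forallP gx /forallP gy /andP[/forallP hc /forallP ht].
apply/forallP => -[i f]; apply/implyP => /andP[/= ik].
rewrite leq_min => /andP[_ fd].
set si := (s0 * 2 ^ kk i)%N in fd *; set bi := (b * 2 ^ kk i)%N in fd *.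
have si0 : (0 < si)%N by rewrite muln_gt0 s0_gt0 expn_gt0.
have U0 : (0 < U i)%N by case: (U i) fd; rewrite ?muln0.
have [cK cg cm] := @group_index s0 n (kk i) g ((f %/ U i) %% si) k ik
  (ltn_pmod _ si0) s0_gt0 gk kn.
have tb : (f %/ U i %/ si < b * 2 ^ kk i)%N.
  by rewrite !ltn_divLR // [(b * _ * _)%N]mulnC.
have [tn tg tm] := @group_index b n (kk i) g (f %/ U i %/ si) k ik tb b_gt0 gk kn.
set c := (X in (X < s0 * 2 ^ n)%N) in cK cg cm.
set t := (X in (X < b * 2 ^ n)%N) in tn tg tm.
pose c' := Ordinal (leq_trans cK s0nK); pose t' := Ordinal tn.
pose u' := Ordinal (ltn_pmod f U0).
have ef : tree_demand t' c' u' = f.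
  apply: val_inj; rewrite /= cm tm -/si -divn_eq -divn_eq.
  exact: modn_small.
have := implyP (hc c'); rewrite inE /= cg eqxx => /(_ isT) /eqP ec.
have := implyP (ht t'); rewrite inE /= tg eqxx => /(_ isT) /eqP et.
have decx z : ~~ error_event s (tree_demand t') z ->
    decoder s (tree_demand t') c' u' (delivery s (tree_demand t') z) (placement s c' z)
    = z (Tagged (fun j => 'I_(N j)) f).
  rewrite /error_event => /existsPn /(_ i) /existsPn /(_ c') /existsPn /(_ u').
  by rewrite negbK ef => /eqP.
change (x (Tagged (fun j => 'I_(N j)) f) == y (Tagged (fun j => 'I_(N j)) f)).
by rewrite -(decx _ (gx t')) -(decx _ (gy t')) et ec.
Qed.

Lemma half_group a k g c : (0 < a)%N -> (c %/ (a * 2 ^ k.+1) = g)%N ->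
  (c %/ (a * 2 ^ k) == g.*2)%N || (c %/ (a * 2 ^ k) == g.*2.+1)%N.
Proof.
move=> a0; rewrite expnSr mulnA divnMA => <-.
set q := (c %/ _)%N; rewrite -[q in q == _]odd_double_half -[q in _ || (q == _)]odd_double_half.
by rewrite divn2; case: (odd q); rewrite ?eqxx ?orbT.
Qed.

Lemma group_split k g x y :
  meet (group_agree k g.*2) (group_agree k g.*2.+1) x y -> group_agree k.+1 g x y.
Proof.
move=> /andP[/andP[/forallP c1 /forallP t1] /andP[/forallP c2 /forallP t2]].
apply/andP; split; apply/forallP => c; apply/implyP; rewrite inE => /eqP.
  by move=> /(half_group s0_gt0) /orP[] h; [move: (c1 c)|move: (c2 c)]; rewrite inE h.
by move=> /(half_group b_gt0) /orP[] h; [move: (t1 c)|move: (t2 c)]; rewrite inE h.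
Qed.

Lemma group_size_le m a g : (0 < a)%N ->
  (#|[pred c : 'I_m | (c %/ (a * 2 ^ 0) == g)%N]| <= a)%N.
Proof.
case: a => // a _; rewrite muln1 -[a.+1 in leqRHS]card_ord.
rewrite -(card_in_imset (f := fun c : 'I_m => inord (c %% a.+1) : 'I_a.+1)).
  exact: max_card.
move=> c1 c2; rewrite !inE => /eqP h1 /eqP h2 /(congr1 val) /=.
rewrite !inordK ?ltn_pmod // => h; apply: val_inj.
by rewrite /= (divn_eq c1 a.+1) (divn_eq c2 a.+1) h1 h2 h.
Qed.

Lemma ln2_gt0 : 0 < ln 2 :> R. Proof. by rewrite ln_gt0 // ltr1n. Qed.

Lemma card_bits m : #|{: bits m}| = (2 ^ m)%N.
Proof. by rewrite card_ffun card_bool card_ord. Qed.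

Lemma ln_exp2 m : ln (2 ^ m)%:R = m%:R * ln 2 :> R.
Proof. by rewrite natrX lnXn // mulr_natl. Qed.

Lemma ent_group0 g :
  ent R good (group_agree 0 g) <= #|good|%:R * ((s0 * mc + b * mr)%N%:R * ln 2).
Proof.
apply: (le_trans (ent_meet_le _ _ _ _)); try exact: agree_equiv.
apply: le_trans (lerD (ent_agree_le _ _ _ _ [ffun=> false])
  (ent_agree_le _ _ _ _ [ffun=> false])) _.
rewrite !card_bits !ln_exp2 -mulrDr ler_wpM2l // !mulrA -mulrDl.
rewrite ler_wpM2r ?(ltW ln2_gt0) // natrD !natrM.
by rewrite lerD // ler_wpM2r // ler_nat group_size_le.
Qed.

Definition ndec k : nat := \sum_(i < L | (kk i <= k)%N) dec i.

Lemma card_decoded k : #|decoded k| = ndec k.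
Proof.
rewrite -sum1_card /ndec.
rewrite -(@sig_big_dep _ _ _ _ (fun i => 'I_(N i)) (fun i => (kk i <= k)%N)
  (fun i (f : 'I_(N i)) => (f < dec i)%N) (fun _ _ => 1%N)).
apply: eq_bigr => i _; rewrite (big_ord_narrow (geq_minl _ _ : dec i <= N i)%N).
by rewrite sum1_card card_ord.
Qed.

Hypothesis good_half : (#|{: library N F}| <= 2 * #|good|)%N.

Lemma good_gt0 : (0 < #|good|)%N.
Proof.
have : (0 < #|{: library N F}|)%N by apply/card_gt0P; exists [ffun=> [ffun=> false]].
by case: #|good| good_half => //; rewrite muln0 leqn0 => /eqP->.
Qed.

(** Libraries agreeing on the decoded files form at most a fraction [1 / 2 ^ (ndec k * F)] of all
    libraries, hence at most twice that fraction of [good]; the factor two costs one bit. *)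
Lemma ent_files k :
  #|good|%:R * (((ndec k * F)%N%:R - 1) * ln 2) <= ent R good (files_agree k).
Proof.
have <- : ln ((2 ^ (ndec k * F))%:R / 2) = ((ndec k * F)%N%:R - 1) * ln 2 :> R.
  by rewrite ln_div ?posrE ?ltr0n ?expn_gt0 // ln_exp2 mulrBl mul1r.
apply: ent_ge => [||w Gw]; first exact: files_equiv.
  by rewrite divr_gt0 ?ltr0n ?expn_gt0.
rewrite mulrAC ler_pdivrMr // -!natrM ler_nat [leqRHS]mulnC.
apply: leq_trans good_half; rewrite card_ffun.
apply: leq_trans (card_agree_le (decoded k) w).
rewrite card_decoded card_bits -expnM [(F * _)%N]mulnC leq_mul2l; apply/orP; right.
by apply/subset_leq_card/fintype.subsetP => x; rewrite !inE => /andP[].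
Qed.

(** The number of files counted twice in all merges below a group of stage [k]: joining
    [2 ^ (k - kk i)] groups takes one merge fewer. Truncated subtraction gives 0 up to stage
    [kk i]. *)
Definition tree_gain k : R := \sum_(i < L) (dec i)%:R * ((2 ^ (k - kk i))%:R - 1).

Lemma tree_gainS k : tree_gain k.+1 = 2 * tree_gain k + (ndec k)%:R.
Proof.
rewrite /tree_gain /ndec natr_sum mulr_sumr [X in _ + X]big_mkcond -big_split /=.
apply: eq_bigr => i _; case: leqP => h.
  by rewrite subSn // expnS natrM; ring.
have -> : (k.+1 - kk i = 0)%N by apply/eqP; rewrite subn_eq0.
have -> : (k - kk i = 0)%N by apply/eqP; rewrite subn_eq0 ltnW.
by rewrite subrr !mulr0 addr0.
Qed.

(** A merge doubles the bound, and submodularity subtracts the entropy of the files that both halves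
    decode. The [+ 1] and [- 1] absorb the bit that [ent_files] loses at each merge. *)
Lemma ent_group_le k g : (k <= n)%N -> (g < 2 ^ (n - k))%N ->
  ent R good (group_agree k g) <= #|good|%:R * ln 2 *
    ((2 ^ k)%:R * ((s0 * mc + b * mr)%N%:R + 1) - 1 - tree_gain k * F%:R).
Proof.
elim: k g => [|k IH] g kn gk.
  apply: le_trans (ent_group0 g) _; rewrite -mulrA ler_wpM2l // mulrC ler_wpM2l ?(ltW ln2_gt0) //.
  by rewrite /tree_gain big1 => [|i _]; [lra|rewrite sub0n subrr mulr0].
have g2 : (g.*2.+1 < 2 ^ (n - k))%N.
  have -> : (n - k = (n - k.+1).+1)%N by rewrite subnSK.
  by rewrite expnS mul2n; lia.
have kn' := ltnW kn.
have h1 := IH _ kn' (ltnW g2); have h2 := IH _ kn' g2.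
have h3 := ent_files k.
have sm : ent R good (group_agree k.+1 g) <=
    ent R good (meet (group_agree k g.*2) (group_agree k g.*2.+1)).
  apply: ent_sub; [|exact: group_equiv|by move=> x y _ _; exact: group_split].
  by apply: meet_equiv; exact: group_equiv.
have sub := ent_submod R (group_equiv k g.*2) (group_equiv k g.*2.+1) (files_equiv k)
  (group_decodes kn' (ltnW g2)) (group_decodes kn' g2).
have := le_trans (lerD sm h3) (le_trans sub (lerD h1 h2)).
rewrite -lerBrDr => /le_trans; apply; rewrite tree_gainS expnS !natrM le_eqVlt.
by apply/orP; left; apply/eqP; ring.
Qed.

(** The root group still determines all decoded files, which turns each [2 ^ (n - kk i) - 1] of
    [tree_gain n] into [2 ^ (n - kk i)]. *)
Lemma tree_bound :
  F%:R * \sum_(i < L) (dec i)%:R * (2 ^ (n - kk i))%:R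
    <= (2 ^ n)%:R * ((s0 * mc + b * mr)%N%:R + 1) :> R.
Proof.
have n0 : (0 < 2 ^ (n - n))%N by rewrite subnn.
have h1 := ent_group_le (leqnn n) n0.
have h2 := ent_files n.
have h3 : ent R good (files_agree n) <= ent R good (group_agree n 0).
  by apply: ent_sub; [exact: group_equiv|exact: files_equiv|exact: group_decodes].
have := le_trans h2 (le_trans h3 h1).
rewrite -mulrA [_ * ln 2]mulrC ler_pM2l ?ltr0n ?good_gt0 // ler_pM2l ?ln2_gt0 //.
have -> : \sum_(i < L) (dec i)%:R * (2 ^ (n - kk i))%:R = tree_gain n + (ndec n)%:R.
  have -> : ndec n = \sum_(i < L) dec i by apply: eq_bigl => i; rewrite kkn.
  by rewrite natr_sum -big_split; apply: eq_bigr => i _ /=; ring.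
by rewrite natrM; lra.
Qed.

End Tree.

(** * Bounds on achievable rates *)

Section Bounds.
Variables (R : realType) (K L : nat) (N U : 'I_L -> nat).

Lemma tree_cutset (s0 b n : nat) (kk : 'I_L -> nat) (Rt M : R) :
  (forall i, (0 < N i)%N) -> (0 < s0)%N -> (0 < b)%N ->
  (s0 * 2 ^ n <= K)%N -> (forall i, (kk i <= n)%N) ->
  0 <= M -> achievable K N U Rt M ->
  \sum_(i < L) (dec N U s0 b kk i)%:R / (2 ^ kk i)%:R <= s0%:R * M + b%:R * Rt.
Proof.
move=> Npos s00 b0 s0nK kkn M0 [Rt0 ach].
set S := \sum_(i < L) _; set C := (X in _ <= X).
have D0 : (0 < b * 2 ^ n)%N by rewrite muln_gt0 b0 expn_gt0.
(* With this tolerance, the union bound over the [b * 2 ^ n] demands leaves at least half of the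
   libraries in [good]. *)
have [|F0 hF] := ach (1 / (2 * (b * 2 ^ n)%:R)); first by rewrite divr_gt0 ?mulr_gt0 ?ltr0n.
have bound F : (F0 <= F)%N -> F%:R * S <= F%:R * C + 1.
  move=> /hF [s hs].
  have half : (#|{: library N F}| <= 2 * #|good s0 b n kk Npos s|)%N.
    rewrite -(@leq_add2r (2 * #|~: good s0 b n kk Npos s|)) -mulnDr cardsC.
    rewrite [(2 * #|_|)%N in leqRHS]mul2n -addnn leq_add2l -(ler_nat R).
    apply: (@le_trans _ _ (2 * \sum_(t < b * 2 ^ n)
        #|error_event s (tree_demand s0 b kk Npos t)|%:R)).
      rewrite natrM ler_wpM2l // -natr_sum ler_nat.
      apply: leq_trans (_ : #|\bigcup_(t < b * 2 ^ n)
        [set x | error_event s (tree_demand s0 b kk Npos t) x]| <= _)%N.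
        apply/subset_leq_card/fintype.subsetP => x; rewrite !inE negb_forall => /existsP[t].
        by rewrite negbK => h; apply/bigcupP; exists t => //; rewrite inE.
      apply: (big_ind2 (fun (B : {set library N F}) m => (#|B| <= m)%N)).
      - by rewrite cards0.
      - by move=> B1 m1 B2 m2 h1 h2; rewrite (leq_trans (leq_card_setU _ _)) ?leq_add.
      - by move=> t _; apply/eq_leq/eq_card => x; rewrite inE.
    have L0 : 0 < #|{: library N F}|%:R :> R.
      by rewrite ltr0n; apply/card_gt0P; exists [ffun=> [ffun=> false]].
    have D0r : 0 < (b * 2 ^ n)%:R :> R by rewrite ltr0n.
    have h (t : 'I_(b * 2 ^ n)) : #|error_event s (tree_demand s0 b kk Npos t)|%:R
       <= 1 / (2 * (b * 2 ^ n)%:R) * #|{: library N F}|%:R :> R.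
      by rewrite -ler_pdivrMr //; exact: hs.
    apply: le_trans (ler_wpM2l _ (ler_sum _ (fun t _ => h t))) _ => //.
    rewrite sumr_const card_ord -[_ *+ (b * _)]mulr_natl le_eqVlt; apply/orP; left.
    by apply/eqP; move: D0r; move: (b * 2 ^ n)%:R => q q0; field; rewrite gt_eqF.
  have := tree_bound R s00 b0 s0nK kkn half.
  have -> : \sum_(i < L) (dec N U s0 b kk i)%:R * (2 ^ (n - kk i))%:R = (2 ^ n)%:R * S :> R.
    rewrite /S mulr_sumr; apply: eq_bigr => i _.
    rewrite -{2}(subnK (kkn i)) expnD natrM; field.
    by rewrite pnatr_eq0 -lt0n expn_gt0.
  rewrite mulrCA ler_pM2l ?ltr0n ?expn_gt0 // => /le_trans; apply.
  rewrite lerD2r natrD !natrM /C mulrDr [F%:R * _]mulrCA [F%:R * (b%:R * _)]mulrCA.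
  by apply: lerD; rewrite ler_wpM2l // mulrC truncn_le mulr_ge0.
(* The additive 1 is negligible: a positive gap [S - C] would satisfy [F * (S - C) <= 1] for all
   large [F]. *)
rewrite leNgt; apply/negP => CS.
have d0 : 0 < S - C by rewrite subr_gt0.
pose F := maxn F0 (Num.truncn (S - C)^-1).+1.
have := bound F (leq_maxl _ _).
have : (S - C)^-1 < F%:R.
  apply: lt_le_trans (_ : (Num.truncn (S - C)^-1).+1%:R <= _); last by rewrite ler_nat leq_maxr.
  have i0 : 0 <= (S - C)^-1 by rewrite invr_ge0 ltW.
  by have /andP[_] := truncn_itv i0.
rewrite -[(S - C)^-1]mul1r ltr_pdivrMr //; lra.
Qed.

(** Sending the whole library serves every demand, so the infimum defining [Rstar] is over a
    nonempty set. *)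
Lemma library_broadcast (M : R) : achievable K N U (#|{: fileIdx N}|%:R) M.
Proof.
split=> // eps eps0; exists 0 => F _.
have e : #|{: library N F}| = #|{: bits (Num.truncn (#|{: fileIdx N}|%:R * F%:R : R))}|.
  by rewrite -natrM natrK !card_ffun !card_bool !card_ord -expnM mulnC.
pose enc (x : library N F) := enum_val (cast_ord e (enum_rank x)).
pose deco y : library N F := enum_val (cast_ord (esym e) (enum_rank y)).
exists (Scheme (fun _ _ => [ffun=> false]) (fun _ => enc)
  (fun d i k u y _ => deco y (Tagged (fun j => 'I_(N j)) (d i k u)))) => d.
rewrite /perr (_ : #|_| = 0%N) ?mul0r ?ltW //; apply: eq_card0 => x.
rewrite !inE; apply/negbTE/existsPn => i; apply/existsPn => k; apply/existsPn => u.
by rewrite negbK /= /deco /enc enum_valK cast_ordK enum_rankK.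
Qed.

End Bounds.

(** * Numerical inequalities for a single level *)

Section Arithmetic.
Variable R : realType.
Implicit Types (x c u t m q s k : R).

(** Applied to [x = t / m], this selects the group size of a level in [I]: between [x / 4] and
    [x / 2], or 1 when [x < 2]. *)
Lemma pow2_quarter x : 0 < x ->
  exists e, x < 4 * (2 ^ e)%:R /\ (e = 0%N /\ x < 2 \/ 2 * (2 ^ e)%:R <= x).
Proof.
move=> x0; pose n := Num.truncn (x / 2); have x2 : 0 <= x / 2 by lra.
have /andP[n1 n2] := truncn_itv x2; rewrite -/n in n1 n2.
have ltn := @trunc_log_ltn 2 n isT; exists (trunc_log 2 n).
have h : n.+1%:R <= (2 ^ (trunc_log 2 n).+1)%:R :> R by rewrite ler_nat.
rewrite expnS natrM in h; split; first by lra.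
have [n0|n0] := posnP n.
  by left; rewrite n0 trunc_log0; split=> //; rewrite n0 in n2; lra.
have : (2 ^ trunc_log 2 n)%:R <= n%:R :> R by rewrite ler_nat trunc_logP.
by right; lra.
Qed.

(** The least exponent works. With [c = 16 * m ^ 2] it gives the smallest groups that are matched
    with at least one broadcast, so that rounding their number up at most doubles it. *)
Lemma pow2_scale c : 0 < c ->
  exists e, 1 <= c * (2 ^ e)%:R /\ (e = 0%N \/ c * (2 ^ e)%:R < 2).
Proof.
move=> c0; have ex : exists e, 1 <= c * (2 ^ e)%:R.
  exists (Num.truncn c^-1).+1; have i0 : 0 <= c^-1 by rewrite invr_ge0 ltW.
  have /andP[_ h] := truncn_itv i0.
  have : (Num.truncn c^-1).+1%:R <= (2 ^ (Num.truncn c^-1).+1)%:R :> R.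
    by rewrite ler_nat ltnW // ltn_expl.
  move=> /(lt_le_trans h); rewrite -[c^-1]mul1r ltr_pdivrMr // mulrC => /ltW //.
case: (ex_minnP ex) => e h emin; exists e; split=> //; case: e => [|e] in h emin *; first by left.
right; rewrite ltNge; apply/negP => h2.
rewrite expnS natrM in h2.
by have := emin e; rewrite ltnn => /(_ _)/negP; apply; lra.
Qed.

Lemma level_uncached u t m q s k : 0 < u -> 0 < m -> 0 < s ->
  k * m < t -> k < 2 * s -> s <= k -> 16 * m ^+ 2 <= q <= 32 * m ^+ 2 ->
  q / 192 * (u * k) * s <= Num.min (u * t ^+ 2) (q * s ^+ 2 * u).
Proof.
move=> u0 m0 s0 kmt ks sk /andP[q1 q2]; have m2 : 0 < m ^+ 2 by rewrite exprn_gt0.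
have q0 : 0 < q by lra.
have k0 : 0 < k by lra.
have -> : q / 192 * (u * k) * s = u * (q * (k * s) / 192) by field.
rewrite [q * _ * u]mulrC le_min !ler_pM2l // -[_ * _ / 192]mulrA ler_pM2l //; apply/andP; split.
  have km0 : 0 < k * m by rewrite mulr_gt0.
  have h1 : (k * m) ^+ 2 <= t ^+ 2 by rewrite ler_sqr ?nnegrE; lra.
  have h2 : k * s <= k ^+ 2 by rewrite expr2 ler_pM2l.
  have h3 : q * (k * s / 192) <= 32 * m ^+ 2 * (k ^+ 2 / 192).
    by apply: ler_pM => //; [exact: ltW|rewrite divr_ge0 ?mulr_ge0 ?ltW|lra].
  have h4 : 0 <= (k * m) ^+ 2 by rewrite sqr_ge0.
  by rewrite exprMn in h1 h4; lra.
have : k * s <= 2 * s * s by rewrite ler_pM2r // ltW.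
rewrite expr2; have : 0 < s * s by rewrite mulr_gt0.
lra.
Qed.

(** Here [u * t ^ 2] is the number of files, [m / t - 1 / k] the cached fraction, and [z] the factor
    [min (N / a, K)] of the rate with memory [a]. The minimum on the right is the number of files,
    since [t < 4 * s * m] and [q >= 16 * m ^ 2]. *)
Lemma level_shared u t m q s k (z : R) : 0 < u -> 0 < m -> 0 < s -> 0 < t -> 1 <= k ->
  k^-1 * t <= m <= (1 + k^-1) * t -> t < 4 * s * m -> (s = 1 \/ 2 * s * m <= t) ->
  16 * m ^+ 2 <= q <= 32 * m ^+ 2 ->
  z <= k -> 0 <= z -> z * (m / t - k^-1) <= 1 ->
  (u * t * m - u * t ^+ 2 / k + q / 192 * (u * z * (1 - (m / t - k^-1)))) * s
    <= Num.min (u * t ^+ 2) (q * s ^+ 2 * u).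
Proof.
move=> u0 m0 s0 t0 k1 /andP[mt1 mt2] ts ss /andP[q1 q2] zk z0 zr.
have k0 : 0 < k by lra.
have m2 : 0 < m ^+ 2 by rewrite exprn_gt0.
have ki : 0 < k^-1 by rewrite invr_gt0.
have ki1 : k^-1 <= 1 by rewrite invf_le1.
have -> : Num.min (u * t ^+ 2) (q * s ^+ 2 * u) = u * t ^+ 2.
  apply/min_idPl; rewrite [leRHS]mulrC ler_pM2l //.
  apply: (@le_trans _ _ ((4 * s * m) ^+ 2)).
    by rewrite ler_sqr ?nnegrE ?mulr_ge0 ?ltW.
  have -> : (4 * s * m) ^+ 2 = 16 * m ^+ 2 * s ^+ 2 by ring.
  by rewrite ler_wpM2r // sqr_ge0.
set w := m / t - k^-1 in zr *.
have wE : t * w = m - t / k by rewrite /w; field; rewrite !gt_eqF.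
have w0 : 0 <= w.
  by rewrite -(pmulr_rge0 _ t0) wE; lra.
have w1 : w <= 1.
  by rewrite -(ler_pM2l t0) wE; lra.
have zb : z * m <= 2 * t.
  have -> : z * m = (z * w + z * k^-1) * t by rewrite /w; field; rewrite !gt_eqF.
  rewrite ler_pM2r //.
  have : z / k <= 1 by rewrite ler_pdivrMr // mul1r.
  lra.
(* The factors 32 from [q] and 2 from [zb] give [64 / 192 = 1 / 3]. *)
have qz : q / 192 * z <= m * t / 3.
  have : q * z <= 32 * m ^+ 2 * z by rewrite ler_wpM2r.
  have : m * (z * m) <= m * (2 * t) by rewrite ler_pM2l.
  by rewrite expr2; lra.
have -> : (u * t * m - u * t ^+ 2 / k + q / 192 * (u * z * (1 - w))) * s =
   u * ((t * (t * w) + q / 192 * z * (1 - w)) * s).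
  by rewrite wE; field; rewrite gt_eqF.
rewrite ler_pM2l //.
apply: (@le_trans _ _ (t * (t * w + m / 3 * (1 - w)) * s)).
  rewrite ler_pM2r // [leRHS]mulrDr lerD2l [leRHS]mulrA ler_wpM2r ?subr_ge0 //; lra.
rewrite -mulrA expr2 ler_pM2l //.
(* At [s = 1] the left side is a convex combination of [t] and [m / 3 <= t]. Otherwise [t * w <= m]
   bounds it by [4 / 3 * m * s], and [2 * s * m <= t]. *)
case: ss => [->|ss].
  rewrite mulr1.
  have m3 : m / 3 <= t.
    have : k^-1 * t <= t by rewrite ger_pMl.
    lra.
  have : m / 3 * (1 - w) <= t * (1 - w) by rewrite ler_wpM2r ?subr_ge0.
  lra.
have tk0 : 0 <= t / k by rewrite divr_ge0 ?ltW.
apply: (@le_trans _ _ ((m + m / 3) * s)); last by lra.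
rewrite ler_pM2r // lerD //; first by lra.
by rewrite ger_pMr ?divr_gt0 //; lra.
Qed.

End Arithmetic.

(** * The memory-sharing allocation against the tree bound *)

Section MemorySharing.
Variables (R : realType) (K L : nat) (N U : 'I_L -> nat) (M : R) (p : 'I_L -> cls).
Hypotheses (K_gt0 : (0 < K)%N) (U_gt0 : forall i, (0 < U i)%N).
Hypothesis KU_le : forall i, (K * U i <= N i)%N.
Hypothesis feas : feasible K N U M p.

Local Notation t := (rt R N U).
Local Notation m := (Mtilde K N U M p).
Local Notation u i := ((U i)%:R : R).
Local Notation k := (K%:R : R).

Lemma N_gt0 i : (0 < N i)%N.
Proof. by apply: leq_trans (KU_le i); rewrite muln_gt0 K_gt0 U_gt0. Qed.

Lemma u_gt0 i : 0 < u i. Proof. by rewrite ltr0n. Qed.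

Lemma k_ge1 : 1 <= k. Proof. by rewrite ler1n. Qed.

Lemma rt_gt0 i : 0 < t i.
Proof. by rewrite sqrtr_gt0 divr_gt0 ?ltr0n // N_gt0. Qed.

Lemma N_rtE i : (N i)%:R = u i * t i ^+ 2.
Proof.
rewrite sqr_sqrtr ?divr_ge0 // mulrC divfK // gt_eqF //; exact: u_gt0.
Qed.

Lemma sqrt_NU i : Num.sqrt ((N i)%:R * (U i)%:R) = u i * t i.
Proof.
rewrite N_rtE; have -> : u i * t i ^+ 2 * u i = (u i * t i) ^+ 2 by ring.
by rewrite sqrtr_sqr ger0_norm // mulr_ge0 // ltW // rt_gt0.
Qed.

Lemma le_K_rt i : k <= t i ^+ 2.
Proof.
rewrite -(ler_pM2l (u_gt0 i)) -N_rtE -natrM ler_nat mulnC; exact: KU_le.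
Qed.

Lemma Mtilde_gt0 : 0 < m.
Proof.
have [[i pi] /(_ i)] := feas; rewrite pi => /andP[h _].
apply: lt_le_trans h; rewrite mulr_gt0 ?rt_gt0 // invr_gt0.
by apply: lt_le_trans k_ge1.
Qed.

Lemma SI_gt0 : 0 < SI R N U p.
Proof.
have [[i pi] _] := feas; rewrite /SI (bigD1 i) ?pi //=.
apply: ltr_pwDl; first by rewrite sqrt_NU mulr_gt0 ?u_gt0 ?rt_gt0.
by apply: sumr_ge0 => j _; rewrite sqrtr_ge0.
Qed.

(** [Mtilde] is defined as the solution of this equation, which is affine in it. *)
Lemma sum_alloc : \sum_(i < L) alloc K N U M p i = M.
Proof.
transitivity (SI R N U p * m + TJ R N p - VI R K N p); last first.
  by rewrite /Mtilde; field; rewrite gt_eqF // SI_gt0.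
rewrite /SI /TJ /VI mulr_suml [X in _ = X + _ - _]big_mkcond
  [X in _ = _ + X - _]big_mkcond.
rewrite [X in _ = _ - X]big_mkcond -big_split -sumrB /=.
by apply: eq_bigr => i _; rewrite /alloc; case: (p i) => /=; rewrite ?add0r ?addr0 ?subr0 ?oppr0.
Qed.

Lemma level_rate i q s : 0 < s -> 16 * m ^+ 2 <= q <= 32 * m ^+ 2 ->
  match p i with
  | cH => k < 2 * s /\ s <= k
  | cI => t i < 4 * s * m /\ (s = 1 \/ 2 * s * m <= t i)
  | cJ => s = 1
  end ->
  (alloc K N U M p i + q / 192 * RSL K (alloc K N U M p i) (N i) (U i)) * s
    <= Num.min (N i)%:R (q * s ^+ 2 * u i).
Proof.
move=> s0 qm; have m0 := Mtilde_gt0; have t0 := rt_gt0 i; have u0 := u_gt0 i.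
have k0 : 0 < k := lt_le_trans ltr01 k_ge1.
have nE := N_rtE i; have n0 : 0 < (N i)%:R :> R by rewrite ltr0n N_gt0.
rewrite /alloc; case: (p i) (feas.2 i) => h.
- move=> [ks sk]; rewrite /RSL eqxx mul0r subr0 mulr1 add0r nE.
  apply: (@level_uncached _ _ _ m) => //.
  by rewrite -ltr_pdivlMl.
- move=> [ts ss]; rewrite sqrt_NU nE.
  set a := _ - _; have aE : a / (u i * t i ^+ 2) = m / t i - k^-1.
    by rewrite /a; field; rewrite !gt_eqF.
  have a0 : 0 <= a.
    have -> : a = u i * t i * (m - k^-1 * t i) by rewrite /a; ring.
    by rewrite (pmulr_rge0 _ (mulr_gt0 u0 t0)) subr_ge0; have /andP[] := h.
  rewrite /RSL nE aE; set z := (if _ then _ else _).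
  have zk : z <= k by rewrite /z; case: ifP => // _; rewrite ge_min lexx orbT.
  have z0 : 0 <= z.
    by rewrite /z; case: ifP => _; rewrite ?le_min ?(ltW k0) // divr_ge0 // -nE.
  have zw : z * (m / t i - k^-1) <= 1.
    rewrite -aE /z; case: eqVneq => [->|an0]; first by rewrite mul0r mulr0.
    have pa : 0 < a by rewrite lt_neqAle eq_sym an0.
    apply: (@le_trans _ _ (u i * t i ^+ 2 / a * (a / (u i * t i ^+ 2)))).
      by rewrite ler_wpM2r ?divr_ge0 -?nE ?ge_min ?lexx.
    by rewrite -nE mulrA divfK ?divff // gt_eqF.
  exact: level_shared k_ge1 h ts ss qm zk z0 zw.
- move=> ->; rewrite /RSL divff ?gt_eqF // subrr !mulr0 addr0 mulr1 expr1n mulr1.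
  rewrite le_min lexx /= nE mulrC ler_pM2r //.
  have tm : t i < m.
    by apply: le_lt_trans h; rewrite mulrDl mul1r lerDl mulr_ge0 ?invr_ge0 // ltW.
  have : t i ^+ 2 <= m ^+ 2 by rewrite ler_sqr ?nnegrE ?ltW.
  have : 0 <= m ^+ 2 by rewrite sqr_ge0.
  by have /andP[+ _] := qm; lra.
Qed.

Lemma feasible_rate_le (Rt : R) : 0 <= M -> achievable K N U Rt M ->
  \sum_(i < L) RSL K (alloc K N U M p i) (N i) (U i) <= 192 * Rt.
Proof.
move=> M0 ach; have m0 := Mtilde_gt0; have m2 : 0 < 16 * m ^+ 2 by rewrite mulr_gt0 ?exprn_gt0.
have k0 : 0 < k := lt_le_trans ltr01 k_ge1.
(* The smallest groups have [2 ^ e0] caches: for small [m] a single cache would be matched with less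
   than one broadcast. *)
have [e0 [e01 e02]] := pow2_scale m2.
pose eK := trunc_log 2 K.
have eKl : (2 ^ eK)%:R <= k by rewrite ler_nat trunc_logP.
have eKu : k < 2 * (2 ^ eK)%:R by rewrite -natrM ltr_nat -expnS trunc_log_ltn.
(* The lower end comes from [K <= t ^ 2], which gives [m * t >= 1]; the upper end from
   [t <= K * m]. *)
have shared_stage i e : p i = cI -> t i < 4 * (2 ^ e)%:R * m ->
    e = 0%N \/ 2 * (2 ^ e)%:R * m <= t i -> (e0 <= e <= eK)%N.
  move=> pi te se; have := feas.2 i; rewrite pi => /andP[mt _].
  have tk : t i <= k * m by rewrite -ler_pdivrMl.
  have mt1 : 1 <= m * t i.
    have : k^-1 * t i * t i <= m * t i by rewrite ler_pM2r // rt_gt0.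
    apply: le_trans; rewrite -mulrA -expr2 ler_pdivlMl // mulr1; exact: le_K_rt.
  apply/andP; split.
    case: e02 => [->//|e02]; rewrite -(@leq_exp2l 2) // ltnW // -(ltr_nat R).
    rewrite -(ltr_pM2l m2); apply: lt_le_trans e02 _.
    have : m * t i <= m * (4 * (2 ^ e)%:R * m) by rewrite ler_pM2l // ltW.
    by rewrite expr2; lra.
  case: se => [->//|se]; apply: trunc_log_max => //; rewrite -(ler_nat R).
  have : 2 * (2 ^ e)%:R <= k by rewrite -(ler_pM2r m0) (le_trans se).
  have : 0 <= (2 ^ e)%:R :> R by [].
  by lra.
have shared_exists i : exists e, t i < 4 * (2 ^ e)%:R * m /\
    (e = 0%N \/ 2 * (2 ^ e)%:R * m <= t i).
  have [e [te se]] := pow2_quarter (divr_gt0 (rt_gt0 i) m0); exists e.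
  split; first by rewrite -ltr_pdivrMr.
  by case: se => [[->]|se]; [left|right; rewrite -ler_pdivlMr].
have e0K : (e0 <= eK)%N.
  have [[i pi] _] := feas; have [e [te se]] := shared_exists i.
  by have /andP[] := shared_stage i e pi te se; exact: leq_trans.
have c0 : 0 <= 16 * m ^+ 2 * (2 ^ e0)%:R by rewrite mulr_ge0 // ltW.
(* As the truncated number is at least 1, [b] is at most twice it; hence the window from 16 to 32
   for [q]. *)
pose b := (Num.truncn (16 * m ^+ 2 * (2 ^ e0)%:R)).+1.
have /andP[b1 b2] := truncn_itv c0.
have s00 : 0 < (2 ^ e0)%:R :> R by rewrite ltr0n expn_gt0.
pose q : R := b%:R / (2 ^ e0)%:R.
have qm : 16 * m ^+ 2 <= q <= 32 * m ^+ 2.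
  rewrite /q ler_pdivlMr // ler_pdivrMr // (ltW b2) /= /b -addn1 natrD; lra.
have q0 : 0 < q by have /andP[+ _] := qm; exact: lt_le_trans.
have /fin_all_exists [e he] (i : 'I_L) : exists e, (e0 <= e <= eK)%N /\
    (alloc K N U M p i + q / 192 * RSL K (alloc K N U M p i) (N i) (U i)) * (2 ^ e)%:R
    <= Num.min (N i)%:R (q * (2 ^ e)%:R ^+ 2 * u i).
  have p0 e : 0 < (2 ^ e)%:R :> R by rewrite ltr0n expn_gt0.
  have lr e := @level_rate i q _ (p0 e) qm.
  case pi : (p i) (feas.2 i) lr => h lr.
  - by exists eK; rewrite e0K leqnn; split=> //; exact: lr.
  - have [e [te se]] := shared_exists i; exists e; split; first exact: shared_stage pi te se.
    by apply: lr; split=> //; case: se => [->|]; [left|right].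
  (* A level in [J] has [s = 1], which forces [e0 = 0]: otherwise [16 * m ^ 2 < 2], against
     [m > t >= 1]. *)
  - exists 0%N; split; last exact: lr.
    rewrite andbT; case: e02 => [->//|e02].
    have tm : t i < m.
      by apply: le_lt_trans h; rewrite mulrDl mul1r lerDl mulr_ge0 ?invr_ge0 // ltW // rt_gt0.
    have : t i ^+ 2 <= m ^+ 2 by rewrite ler_sqr ?nnegrE ?ltW // rt_gt0.
    have := le_K_rt i; have := k_ge1; have : 1 <= (2 ^ e0)%:R :> R by rewrite ler1n expn_gt0.
    move=> x1 x2 x3 x4; have : 16 * m ^+ 2 * 1 <= 16 * m ^+ 2 * (2 ^ e0)%:R by rewrite ler_pM2l.
    lra.
(* Stages are counted from the smallest groups, which already hold [2 ^ e0] caches. *)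
pose kk i := (e i - e0)%N.
have kkE i : (2 ^ e i)%:R = (2 ^ e0)%:R * (2 ^ kk i)%:R :> R.
  by rewrite -natrM -expnD subnKC //; have [/andP[]] := he i.
have := @tree_cutset R K L N U (2 ^ e0) b (eK - e0) kk Rt M N_gt0.
rewrite expn_gt0 -expnD subnKC // trunc_logP // => /(_ isT isT isT _ M0 ach).
have -> : (2 ^ e0)%:R * M + b%:R * Rt = (2 ^ e0)%:R * (M + q * Rt).
  by rewrite /q; field; rewrite gt_eqF.
move=> tc; have {tc} := tc (fun i => leq_sub2r e0 (proj2 (andP (he i).1))).
move=> tc; have : (2 ^ e0)%:R * (M + q / 192 *
    \sum_(i < L) RSL K (alloc K N U M p i) (N i) (U i)) <= (2 ^ e0)%:R * (M + q * Rt).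
  apply: le_trans tc; rewrite -[X in X + _]sum_alloc !mulr_sumr -big_split mulr_sumr /=.
  apply: ler_sum => i _; have [_ h] := he i.
  have k1 : 0 < (2 ^ kk i)%:R :> R by rewrite ltr0n expn_gt0.
  rewrite ler_pdivlMr // mulrAC -kkE mulrC; apply: le_trans h _.
  rewrite /dec -expnD subnKC; last by have [/andP[]] := he i.
  have -> : q * (2 ^ e i)%:R ^+ 2 * u i = (2 ^ e i * (b * 2 ^ kk i) * U i)%N%:R.
    by rewrite !natrM kkE /q; field; rewrite gt_eqF.
  rewrite /minn; case: ifP => _; by rewrite ge_min lexx ?orbT.
rewrite ler_pM2l // lerD2l -mulrA ler_pM2l //; lra.
Qed.

End MemorySharing.

(** * Passage to the optimal rate *)

Theorem theorem2 (R : realType) (K L : nat) (N U : 'I_L -> nat) (M r : R) :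
  (0 < K)%N -> (0 < L)%N ->
  (forall i, (0 < U i)%N) ->
  (forall i, (K * U i <= N i)%N) ->
  (forall i j : 'I_L, i != j ->
     (U j)%:R / (N j)%:R <= (U i)%:R / (N i)%:R :> R ->
     1 / (1 / 80) ^+ 2 <= ((U i)%:R / (N i)%:R) / ((U j)%:R / (N j)%:R) :> R) ->
  0 <= M ->
  msrate K N U M r ->
  r <= 192 * Rstar K N U M.
Proof.
move=> K0 _ U0 KU _ M0 ms; rewrite -ler_pdivrMl //; apply: lb_le_inf.
  by exists #|{: fileIdx N}|%:R; exact: library_broadcast.
move=> Rt ach; rewrite ler_pdivrMl //.
case: ms => [[_ [p [feas ->]]]|[_ ->]]; first exact: feasible_rate_le.
rewrite big1 => [|i _]; first by rewrite mulr_ge0 //; case: ach.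
by rewrite /RSL divff ?subrr ?mulr0 // pnatr_eq0 -lt0n (N_gt0 K0 U0 KU).
Qed.
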